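(* Let $p$ be a prime and let $k$ be a positive integer. Then there exists a constant $r_0(p,k)$ such that for all $r \geq r_0(p,k)$ the following holds: for any positive integer $h$, put $q=p^h$, and let $\mathcal{P}$ be a finite classical polar space of rank $r$ over the field $\mathbb{F}_q$. Then $\mathcal{P}$ does not possess a family $\mathcal{O}$ of $k$-spaces such that each generator of $\mathcal{P}$ contains precisely one element of $\mathcal{O}$.
   Context: A finite classical polar space is the geometry of totally isotropic (totally singular) subspaces of a vector space $V(n,q)=\mathbb{F}_q^n$ with respect to a non-degenerate quadratic form or non-degenerate reflexive sesquilinear form; the finite classical polar spaces of rank $r$ are $Q^+(2r-1,q)$, $H(2r-1,q)$ ($q$ square), $W(2r-1,q)$, $Q(2r,q)$, $H(2r,q)$ ($q$ square), $Q^-(2r+1,q)$. Dimensions are algebraic (vector-space) dimensions: a $k$-space of $\mathcal{P}$ is a totally isotropic subspace of dimension $k$. The rank $r$ is the maximal dimension of a totally isotropic subspace, and generators are the totally isotropic subspaces of dimension $r$. *)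

(* Defs.v *)
From HB Require Import structures.
From mathcomp Require Import all_boot all_order all_algebra all_field.
Set Implicit Arguments.
Unset Strict Implicit.
Unset Printing Implicit Defensive.
Import GRing.Theory.
Local Open Scope ring_scope.

Section ClassicalForms.
Variables (F : finFieldType) (n : nat).

(* Quadratic form v |-> v A v^T (every quadratic form on F^n has this shape). *)
Definition qform (A : 'M[F]_n) (v : 'rV[F]_n) : F := (v *m A *m v^T) 0 0.
Definition qpolar (A : 'M[F]_n) (u v : 'rV[F]_n) : F :=
  qform A (u + v) - qform A u - qform A v.
Definition nondeg_quad (A : 'M[F]_n) : Prop :=
  forall u : 'rV[F]_n, qform A u = 0 -> (forall v, qpolar A u v = 0) -> u = 0.

Definition bform (M : 'M[F]_n) (u v : 'rV[F]_n) : F := (u *m M *m v^T) 0 0.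
Definition sform (e : nat) (M : 'M[F]_n) (u v : 'rV[F]_n) : F :=
  (u *m M *m (map_mx (fun x => x ^+ e) v)^T) 0 0.

Definition nondeg_form (B : 'rV[F]_n -> 'rV[F]_n -> F) : Prop :=
  forall u, (forall v, B u v = 0) -> u = 0.

(* The classical kinds of forms:
   - QuadForm A : orthogonal polar spaces Q^+(2r-1,q), Q(2r,q), Q^-(2r+1,q);
   - AltForm M  : symplectic polar spaces W(2r-1,q);
   - HermForm e M : Hermitian polar spaces H(2r-1,q), H(2r,q), where
     e^2 = q and x |-> x^e is the involutory field automorphism. *)
Inductive classical_form :=
  | QuadForm of 'M[F]_n
  | AltForm of 'M[F]_n
  | HermForm of nat & 'M[F]_n.

Definition cf_valid (f : classical_form) : Prop :=
  match f with
  | QuadForm A => nondeg_quad A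
  | AltForm M => (forall v, bform M v v = 0) /\ nondeg_form (bform M)
  | HermForm e M => (e * e = #|F|)%N /\
      (forall u v, sform e M v u = (sform e M u v) ^+ e) /\
      nondeg_form (sform e M)
  end.

Definition cf_tiso (f : classical_form) (U : {vspace 'rV[F]_n}) : Prop :=
  match f with
  | QuadForm A => forall u, u \in U -> qform A u = 0
  | AltForm M => forall u v, u \in U -> v \in U -> bform M u v = 0
  | HermForm e M => forall u v, u \in U -> v \in U -> sform e M u v = 0
  end.

Definition polar_rank (f : classical_form) (r : nat) : Prop :=
  (exists U, cf_tiso f U /\ \dim U = r) /\
  (forall U, cf_tiso f U -> (\dim U <= r)%N).

Definition generator (f : classical_form) (r : nat) (U : {vspace 'rV[F]_n}) : Prop :=
  cf_tiso f U /\ \dim U = r.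

End ClassicalForms.

(* Main.v *)
(* A counting argument played against a p-rank bound, as in Blokhuis and Moorhouse's bound for
   ovoids. Write B for the bilinear, polar or Hermitian form and call the elements of O
   blocks. Fix a generator G, the block X0 inside it and a nonzero x in X0. For a singular
   vector a with B(a, x) = 1, the subspace (G :&: a^perp) + <[a]> is a generator not
   containing x, so its block is not contained in G and determines a modulo G. Letting a run
   over lifts of the functionals on G taking the value 1 at x gives q^(r-1) distinct blocks
   inside a subspace of dimension at most 2r.

   Two distinct blocks are never orthogonal, since otherwise a generator would contain both.
   Hence the matrix with entries prod_(i,j) (1 - B(x_i, y_j)^(q-1)), for blocks with bases
   (x_i) and (y_j), is the identity. Since q - 1 = (p - 1)(1 + p + ... + p^(h-1)) and
   Frobenius is additive, its rank is at most (1 + ((2r)^(p-1))^h)^(k^2). So p^(h(r-1)) is at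
   most the h-th power of a polynomial in r whose degree depends only on p and k. *)
Require Import Defs.
From HB Require Import structures.
From mathcomp Require Import all_boot all_order all_algebra all_field.
From mathcomp Require Import zify ring.
Set Implicit Arguments.
Unset Strict Implicit.
Unset Printing Implicit Defensive.
Import GRing.Theory.

(** * Rank of matrices under entrywise operations *)

Section FactorRank.
Local Open Scope ring_scope.
Variables (F : fieldType) (I J : Type).
Implicit Types (M : I -> J -> F) (D : nat).

(** Rank is measured by a factorization through [T], so that entrywise sums and products of matrices
    become sums and products of types. *)
Definition rank_le M D := exists (T : finType) (f : I -> T -> F) (g : J -> T -> F),
  (#|T| <= D)%N /\ forall i j, M i j = \sum_t f i t * g j t.

Lemma rank_le_ext M M' D : (forall i j, M i j = M' i j) -> rank_le M' D -> rank_le M D.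
Proof.
by move=> eqM [T [f [g [leD M'E]]]]; exists T, f, g; split=> // i j; rewrite eqM.
Qed.

Lemma rank_le_mono M D D' : (D <= D')%N -> rank_le M D -> rank_le M D'.
Proof. by move=> leD [T [f [g [leT ME]]]]; exists T, f, g; split=> //; apply: leq_trans leD. Qed.

Lemma rank_le_const c : rank_le (fun _ _ => c) 1.
Proof.
exists unit, (fun _ _ => c), (fun _ _ => 1); split; first by rewrite card_unit.
by move=> i j; rewrite (big_pred1 tt) ?mulr1 // => -[].
Qed.

Lemma rank_leD M1 M2 D1 D2 : rank_le M1 D1 -> rank_le M2 D2 ->
  rank_le (fun i j => M1 i j + M2 i j) (D1 + D2).
Proof.
move=> [T1 [f1 [g1 [le1 E1]]]] [T2 [f2 [g2 [le2 E2]]]].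
exists (T1 + T2)%type, (fun i t => match t with inl t => f1 i t | inr t => f2 i t end),
  (fun j t => match t with inl t => g1 j t | inr t => g2 j t end).
by split=> [|i j]; rewrite ?card_sum ?leq_add // big_sumType E1 E2.
Qed.

Lemma rank_leM M1 M2 D1 D2 : rank_le M1 D1 -> rank_le M2 D2 ->
  rank_le (fun i j => M1 i j * M2 i j) (D1 * D2).
Proof.
move=> [T1 [f1 [g1 [le1 E1]]]] [T2 [f2 [g2 [le2 E2]]]].
exists (T1 * T2)%type, (fun i t => f1 i t.1 * f2 i t.2), (fun j t => g1 j t.1 * g2 j t.2).
split=> [|i j]; first by rewrite card_prod leq_mul.
rewrite E1 E2 big_distrlr pair_big; apply: eq_bigr => t _ /=.
by rewrite mulrACA.
Qed.

Lemma rank_leN M D : rank_le M D -> rank_le (fun i j => - M i j) D.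
Proof.
move=> [T [f [g [leD ME]]]]; exists T, (fun i t => - f i t), g; split=> // i j.
by rewrite ME -sumrN; apply: eq_bigr => t _; rewrite mulNr.
Qed.

Lemma rank_leX M D m : rank_le M D -> rank_le (fun i j => M i j ^+ m) (D ^ m).
Proof.
move=> rkM; elim: m => [|m IHm]; first exact: rank_le_const.
by rewrite expnS; apply: (rank_le_ext _ (rank_leM rkM IHm)) => i j; rewrite exprS.
Qed.

Lemma rank_le_prod m (M : 'I_m -> I -> J -> F) D : (forall l, rank_le (M l) D) ->
  rank_le (fun i j => \prod_l M l i j) (D ^ m).
Proof.
elim: m M => [|m IHm] M rkM.
  by apply: (rank_le_ext _ (rank_le_const 1)) => i j; rewrite big_ord0.
rewrite expnS; apply: (rank_le_ext _ (rank_leM (rkM ord0) (IHm _ (fun l => rkM (lift ord0 l))))).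
by move=> i j; rewrite big_ord_recl.
Qed.

(** The Frobenius map is additive, so the power distributes over the factorization and [D] does not
    grow; [rank_leX] would only give [D ^ p]. *)
Lemma rank_le_Frobenius p M D : p \in [pchar F] -> rank_le M D ->
  rank_le (fun i j => M i j ^+ p) D.
Proof.
move=> charFp [T [f [g [leD ME]]]].
exists T, (fun i t => f i t ^+ p), (fun j t => g j t ^+ p); split=> // i j.
rewrite ME -(pFrobenius_autE charFp) raddf_sum /=; apply: eq_bigr => t _.
by rewrite pFrobenius_autE exprMn.
Qed.

(** Induction on [h] through [p ^ h.+1 - 1 = (p - 1) + (p ^ h - 1) * p]: the factor [p] costs
    nothing by Frobenius. *)
Lemma rank_le_pred_expn p h M D : p \in [pchar F] -> rank_le M D ->
  rank_le (fun i j => M i j ^+ (p ^ h).-1) ((D ^ p.-1) ^ h).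
Proof.
move=> charFp rkM; have p_gt0 := prime_gt0 (pcharf_prime charFp).
elim: h => [|h IHh]; first by apply: (rank_le_ext _ (rank_le_const 1)) => i j; rewrite expr0.
rewrite !expnS.
apply: (rank_le_ext _ (rank_leM (rank_leX p.-1 rkM) (rank_le_Frobenius charFp IHh))) => i j.
rewrite -exprM -exprD; congr (_ ^+ _).
have : (0 < p ^ h)%N by rewrite expn_gt0 p_gt0.
case: (p ^ h)%N => // a _; nia.
Qed.

End FactorRank.

Section IdentityRank.
Local Open Scope ring_scope.

(** The factorization reads [A *m B = 1] with inner dimension [#|T|]. *)
Lemma rank_le_id (F : fieldType) (I : finType) (D : nat) :
  rank_le (fun i j : I => (i == j)%:R : F) D -> (#|I| <= D)%N.
Proof.
move=> [T [f [g [leD ME]]]]; apply: leq_trans leD.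
pose A : 'M[F]_(#|I|, #|T|) := \matrix_(i, t) f (enum_val i) (enum_val t).
pose B : 'M[F]_(#|T|, #|I|) := \matrix_(t, j) g (enum_val j) (enum_val t).
apply: (@mulmx1_min _ _ _ A B); apply/matrixP => i j; rewrite !mxE.
rewrite -(inj_eq enum_val_inj) ME [RHS](reindex (@enum_val T T)) /=.
  by apply: eq_bigr => t _; rewrite !mxE.
exact/onW_bij/enum_val_bij.
Qed.

End IdentityRank.

(** * Polar geometries given by a pairing *)

Section PolarGeometry.
Local Open Scope ring_scope.
Variables (F : finFieldType) (n : nat).
Notation V := 'rV[F]_n.
Implicit Types (u v w x a : V) (U G W : {vspace V}).

(** Only linearity in [u] is built in: [N] is an arbitrary map, which leaves room for Hermitian
    forms, semilinear in [v]. *)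
Definition pairing (N : V -> 'cV[F]_n) u v : F := (u *m N v) 0 0.

(** Below, [eps] is -1 for alternating forms and 1 otherwise; [sigma] is [x ^+ e] for Hermitian
    forms and the identity otherwise. *)
Definition reflexive_pairing (N : V -> 'cV[F]_n) := exists (eps : F) (sigma : F -> F),
  [/\ {morph sigma : c d / c + d}, {morph sigma : c d / c * d},
      forall c, sigma c = 0 -> c = 0
    & forall u v, pairing N v u = eps * sigma (pairing N u v)].

(* The axioms common to all classical polar spaces.  In characteristic 2 the polar form of a
   quadratic form may be degenerate, so [tiso_nondeg] is only required of singular vectors. *)
Record polar_geometry (N : V -> 'cV[F]_n) (tiso : {vspace V} -> Prop) : Prop := {
  pairing_sym : reflexive_pairing N;
  tiso_sub : forall U W, tiso U -> (W <= U)%VS -> tiso W;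
  tiso_perp : forall U u v, tiso U -> u \in U -> v \in U -> pairing N u v = 0;
  tiso_nondeg : forall U u, tiso U -> u \in U -> (forall v, pairing N v u = 0) -> u = 0;
  tiso_add : forall U a, tiso U -> tiso <[a]>%VS ->
    (forall u, u \in U -> pairing N u a = 0) -> tiso (U + <[a]>)%VS;
  tiso_translate : forall v x, tiso <[x]>%VS -> pairing N v x = 1 ->
    exists c, tiso <[v + c *: x]>%VS }.

Section Pairing.
Variable N : V -> 'cV[F]_n.
Local Notation B := (pairing N).

Lemma pairingDl u v w : B (u + v) w = B u w + B v w.
Proof. by rewrite /pairing mulmxDl mxE. Qed.

Lemma pairingZl c u w : B (c *: u) w = c * B u w.
Proof. by rewrite /pairing -scalemxAl mxE. Qed.

Lemma pairingBl u v w : B (u - v) w = B u w - B v w.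
Proof. by rewrite /pairing mulmxBl !mxE. Qed.

Lemma pairing_suml (I : finType) (f : I -> V) w : B (\sum_i f i) w = \sum_i B (f i) w.
Proof. by rewrite /pairing mulmx_suml summxE. Qed.

Lemma pairing_refl u v : reflexive_pairing N -> B u v = 0 -> B v u = 0.
Proof.
move=> [eps [sigma [sD _ _ symB]]] uv; rewrite symB uv.
suff -> : sigma 0 = 0 by rewrite mulr0.
by apply: (@addrI _ (sigma 0)); rewrite -sD !addr0.
Qed.

End Pairing.

(** * Generators and the blocks inside them *)

Section Blocks.
Variables (N : V -> 'cV[F]_n) (tiso : {vspace V} -> Prop) (r : nat).
Hypothesis geom : polar_geometry N tiso.
Hypothesis rank_exists : exists G, tiso G /\ \dim G = r.
Hypothesis rank_max : forall U, tiso U -> (\dim U <= r)%N.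

Local Notation B := (pairing N).

Definition perp a : {vspace V} := lker (linfun (mulmxr (N a) : V -> 'M[F]_1)).

Lemma memv_perp u a : (u \in perp a) = (B u a == 0).
Proof.
rewrite memv_ker lfunE /=; apply/eqP/eqP => [|B0]; first by rewrite /pairing => ->; rewrite mxE.
by apply/matrixP => i j; rewrite !ord1 [RHS]mxE.
Qed.

Lemma dim_cap_perp U a : (\dim U <= (\dim (U :&: perp a)).+1)%N.
Proof.
rewrite -(limg_ker_dim (linfun (mulmxr (N a) : V -> 'M[F]_1)) U) -[leqRHS]addn1 leq_add2l.
by apply: (leq_trans (dimvS (subvf _))); rewrite dimvf dim_matrix.
Qed.

Definition pivot G a : {vspace V} := (G :&: perp a + <[a]>)%VS.

Lemma tiso_pivot G a : tiso G -> tiso <[a]>%VS -> tiso (pivot G a).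
Proof.
move=> tG ta; apply: (tiso_add geom) => //; first exact: (tiso_sub geom tG (capvSl _ _)).
by move=> u; rewrite memv_cap memv_perp => /andP[_ /eqP].
Qed.

(** Maximality of [r] bounds the dimension above. Below, cutting by [perp a] loses at most one
    dimension, which [a] restores when outside [G]; otherwise [G] lies in its own pivot. *)
Lemma dim_pivot G a : tiso G -> \dim G = r -> tiso <[a]>%VS -> \dim (pivot G a) = r.
Proof.
move=> tG dG ta; apply/eqP; rewrite eqn_leq (rank_max (tiso_pivot tG ta)) /=.
have [aG | aG] := boolP (a \in G).
  rewrite -dG; apply/dimvS/subvP => u uG; rewrite -[X in X \in _]addr0 memv_add ?mem0v //.
  by rewrite memv_cap uG memv_perp (tiso_perp geom tG) ?eqxx.
rewrite /pivot dimv_disjoint_sum; last first.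
  apply/eqP; rewrite -subv0; apply/subvP => u; rewrite !memv_cap => /andP[/andP[uG _]].
  move/vlineP => [c cu]; rewrite memv0; move: uG; rewrite cu.
  have [-> | c0] := eqVneq c 0; first by rewrite scale0r.
  by rewrite rpredZeq (negPf c0) (negPf aG).
rewrite dim_vline; have -> : a != 0 by apply: contraNneq aG => ->; rewrite mem0v.
by rewrite addn1 -dG dim_cap_perp.
Qed.

(** Pivot any generator at the vectors in turn: orthogonality keeps those already included. *)
Lemma generator_containing (s : seq V) :
  (forall a, a \in s -> tiso <[a]>%VS) -> (forall a b, a \in s -> b \in s -> B a b = 0) ->
  exists G, [/\ tiso G, \dim G = r & forall a, a \in s -> a \in G].
Proof.
elim: s => [|a s IHs] ts ps; first by have [G [tG dG]] := rank_exists; exists G.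
have [||G [tG dG sG]] := IHs.
- by move=> b bs; apply: ts; rewrite inE bs orbT.
- by move=> b c bs cs; apply: ps; rewrite inE ?bs ?cs orbT.
have ta : tiso <[a]>%VS by apply: ts; rewrite mem_head.
exists (pivot G a); split; [exact: tiso_pivot | exact: dim_pivot |].
move=> b; rewrite inE => /predU1P[-> | bs].
  by rewrite -[X in X \in _]add0r memv_add ?mem0v ?memv_line.
rewrite -[X in X \in _]addr0 memv_add ?mem0v // memv_cap sG // memv_perp ps ?mem_head ?eqxx //.
by rewrite inE bs orbT.
Qed.

Variables (k : nat) (O : {vspace V} -> Prop).
Hypothesis k_gt0 : (0 < k)%N.
Hypothesis O_tiso : forall U, O U -> tiso U /\ \dim U = k.
Hypothesis O_unique : forall G, tiso G -> \dim G = r -> exists! U, O U /\ (U <= G)%VS.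

Lemma O_common_generator U W G : O U -> O W -> tiso G -> \dim G = r ->
  (U <= G)%VS -> (W <= G)%VS -> U = W.
Proof.
move=> OU OW tG dG UG WG; have [Z [_ Zu]] := O_unique tG dG.
by rewrite -(Zu U) // -(Zu W).
Qed.

Lemma O_perp_eq U W : O U -> O W ->
  (forall a b, a \in vbasis U -> b \in vbasis W -> B a b = 0) -> U = W.
Proof.
move=> OU OW UW; have [[tU _] [tW _]] := (O_tiso OU, O_tiso OW).
have [||G [tG dG sG]] := @generator_containing (vbasis U ++ vbasis W).
- move=> a; rewrite mem_cat => /orP[] /vbasis_mem; rewrite memvE => sa.
    exact: (tiso_sub geom tU).
  exact: (tiso_sub geom tW).
- move=> a b; rewrite !mem_cat => /orP[] Ha /orP[] Hb; [|exact: UW| |].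
  + by apply: (tiso_perp geom tU); apply: vbasis_mem.
  + by apply: (pairing_refl (pairing_sym geom)); apply: UW.
  + by apply: (tiso_perp geom tW); apply: vbasis_mem.
apply: (O_common_generator OU OW tG dG).
  rewrite -(span_basis (vbasisP U)); apply/span_subvP => a aU.
  by apply: sG; rewrite mem_cat aU.
rewrite -(span_basis (vbasisP W)); apply/span_subvP => a aW.
by apply: sG; rewrite mem_cat aW orbT.
Qed.

(* [K] encodes [v |-> (B v e_j)_j] for a basis [e] of [G], and the rows of [P] are dual to [e]. *)
Lemma dual_family G : tiso G -> \dim G = r ->
  exists (K : 'M[F]_(n, r)) (P : 'M[F]_(r, n)),
    P *m K = 1%:M /\ (forall v, v *m K = 0 <-> forall g, g \in G -> B v g = 0).
Proof.
move=> tG dG.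
have [e eG] : exists e : r.-tuple V, basis_of G e.
  by rewrite -dG; exists (vbasis G); apply: vbasisP.
pose K : 'M[F]_(n, r) := \matrix_(i, j) N e`_j i 0.
have KE v j : (v *m K) 0 j = B v e`_j.
  by rewrite /pairing !mxE; apply: eq_bigr => i _; rewrite mxE.
have eiG (j : 'I_r) : e`_j \in G.
  by rewrite -(span_basis eG); apply/memv_span/mem_nth; rewrite size_tuple.
(* A relation [c] between the columns of [K] makes the combination of the [e_j] with coefficients
   [sigma (c_j)] orthogonal to every vector, hence zero; [sigma] appears on exchanging the arguments
   of [B]. *)
have freeK : row_free K^T.
  apply: inj_row_free => c cK.
  move: (pairing_sym geom) => [eps [sigma [sD sM s0 symB]]].
  have s00 : sigma 0 = 0 by apply: (@addrI _ (sigma 0)); rewrite -sD !addr0.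
  have sum0 v : \sum_j c 0 j * B v e`_j = 0.
    have : (v *m (c *m K^T)^T) 0 0 = 0 by rewrite cK trmx0 mulmx0 mxE.
    rewrite trmx_mul trmxK mulmxA mxE => vK; rewrite -[RHS]vK.
    by apply: eq_bigr => j _; rewrite KE mxE mulrC.
  have g0 : \sum_j sigma (c 0 j) *: e`_j = 0.
    apply: (tiso_nondeg geom tG); first by apply: memv_suml => j _; rewrite memvZ.
    move=> v; apply: (pairing_refl (pairing_sym geom)); rewrite pairing_suml.
    have -> : \sum_j B (sigma (c 0 j) *: e`_j) v = eps * sigma (\sum_j c 0 j * B v e`_j).
      rewrite (big_morph sigma sD s00) mulr_sumr; apply: eq_bigr => j _.
      by rewrite pairingZl (symB v) sM mulrCA.
    by rewrite sum0 s00 mulr0.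
  apply/rowP => j; rewrite mxE; apply: s0.
  exact: (freeP (basis_free eG) (fun j => sigma (c 0 j)) g0).
have fullK : row_full K by rewrite /row_full -mxrank_tr.
exists K, (pinvmx K); split; first exact: mulVpmx.
move=> v; split=> [vK g gG | vG].
  apply: (pairing_refl (pairing_sym geom)); rewrite -(span_basis eG) in gG.
  rewrite (coord_span gG) pairing_suml.
  rewrite big1 // => j _; rewrite pairingZl (pairing_refl (pairing_sym geom) (u := v)) ?mulr0 //.
  by rewrite -KE vK mxE.
by apply/rowP => j; rewrite KE mxE vG.
Qed.

(** [T] will be an affine hyperplane of functionals on [G]; the factor [#|F|] on the right avoids
    the exponent [r - 1]. [V0] is [G] plus the span of the dual rows. *)
Lemma many_blocks : exists (T : finType) (X : T -> {vspace V}) (V0 : {vspace V}),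
  [/\ (#|F| ^ r <= #|F| * #|T|)%N, (\dim V0 <= r + r)%N, injective X
    & forall t, O (X t) /\ (X t <= V0)%VS].
Proof.
have [G [tG dG]] := rank_exists.
have [X0 [[OX0 X0G] _]] := O_unique tG dG.
have [tX0 dX0] := O_tiso OX0.
pose x := vpick X0; have xX0 : x \in X0 := memv_pick X0.
have xG : x \in G by apply: (subvP X0G).
have x_neq0 : x != 0 by rewrite vpick0 -dimv_eq0 dX0 -lt0n.
have tx : tiso <[x]>%VS by apply: (tiso_sub geom tX0); rewrite -memvE.
have [K [P [PK KE]]] := dual_family tG dG.
have GK g : g \in G -> g *m K = 0.
  by move=> gG; apply/KE => g' g'G; apply: (tiso_perp geom tG).
have [c0 c0x] : exists c0 : 'rV[F]_r, B (c0 *m P) x = 1.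
  have [v vx] : exists v, B v x != 0.
    have [/existsP // | /existsPn vx] := boolP [exists v, B v x != 0].
    case/eqP: x_neq0; apply: (tiso_nondeg geom tG xG) => v.
    by apply/eqP; have := vx v; rewrite negbK.
  (* [v] and [v *m K *m P] have the same image under [K], so their difference is orthogonal to [G],
     in particular to [x]. *)
  exists ((B v x)^-1 *: v *m K); rewrite -!scalemxAl pairingZl.
  suff -> : B (v *m K *m P) x = B v x by rewrite mulVf.
  apply/eqP; rewrite eq_sym -subr_eq0 -pairingBl; apply/eqP.
  by move: x xG {xX0 x_neq0 tx vx}; apply/KE; rewrite mulmxBl -(mulmxA (v *m K)) PK mulmx1 subrr.
pose T : finType := {c : 'rV[F]_r | B (c *m P) x == 1}.
(* A multiple of [x] makes the lift singular without changing its image under [K], since [x] lies in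
   [G]. *)
have singular_lift (t : T) : exists z : F, tiso <[sval t *m P + z *: x]>%VS.
  by apply: (tiso_translate geom tx); apply/eqP/(valP t).
have [z tz] := fin_all_exists singular_lift.
pose a t := sval t *m P + z t *: x.
have ax t : B (a t) x = 1.
  rewrite pairingDl (eqP (valP t)) pairingZl (tiso_perp geom tx) ?memv_line //.
  by rewrite mulr0 addr0.
have aK t : a t *m K = sval t.
  by rewrite mulmxDl -mulmxA PK mulmx1 -scalemxAl (GK x) // scaler0 addr0.
have tp t : tiso (pivot G (a t)) by apply: tiso_pivot => //; apply: tz.
have dp t : \dim (pivot G (a t)) = r by apply: dim_pivot => //; apply: tz.
have block t : exists U, O U /\ (U <= pivot G (a t))%VS.
  by have [U [OU _]] := O_unique (tp t) (dp t); exists U.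
have [X XP] := fin_all_exists block.
have xNpivot t : x \notin pivot G (a t).
  apply: contraTN isT => xp; have := ax t.
  rewrite (tiso_perp geom (tp t)) // => [/esym/eqP|]; first by rewrite oner_eq0.
  by rewrite -[X in X \in _]add0r memv_add ?mem0v ?memv_line.
(* A block inside [G] would be [X0], which contains [x], whereas the pivot does not. *)
have XnotG t : exists2 y, y \in X t & y \notin G.
  have [OX Xp] := XP t; apply/subvPn/negP => XG.
  have eqX := O_common_generator OX OX0 tG dG XG X0G.
  by case/negP: (xNpivot t); apply: (subvP Xp); rewrite eqX.
have X_decomp t y : y \in X t -> exists2 g, g \in G & exists c, y = g + c *: a t.
  have [_ /subvP Xp] := XP t; move=> /Xp /memv_addP[g].
  rewrite memv_cap => /andP[gG _] [b /vlineP[c ->] ->].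
  by exists g => //; exists c.
exists T, X, (G + limg (linfun (mulmxr P : 'rV[F]_r -> V)))%VS; split.
(* Adding a multiple of [c0] moves any functional into [T]; recording its original value at [x]
   makes the move reversible. *)
- have psi_subproof c : B ((c + (1 - B (c *m P) x) *: c0) *m P) x == 1.
    by rewrite mulmxDl -scalemxAl pairingDl pairingZl c0x mulr1 addrC subrK.
  pose phi c : F * T :=
    (B (c *m P) x, exist (fun d : 'rV[F]_r => B (d *m P) x == 1) _ (psi_subproof c)).
  have phi_inj : injective phi by move=> c d [-> /addIr].
  by have := leq_card phi phi_inj; rewrite card_mx mul1n card_prod.
- apply: leq_trans (dimv_add_leqif _ _) _; rewrite dG leq_add2l.
  apply: (@leq_trans (\dim {:'rV[F]_r})); last by rewrite dimvf dim_matrix mul1r.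
  by rewrite -[leqRHS](limg_ker_dim (linfun (mulmxr P : 'rV[F]_r -> V))) leq_addl.
(* [K] kills the [G]-part of the common vector [y], leaving proportional functionals; as both take
   the value 1 at [x], they coincide. *)
- move=> t t' eqX; have [y yt yG] := XnotG t.
  have [g gG [c yc]] := X_decomp t y yt.
  rewrite eqX in yt; have [g' g'G [c' yc']] := X_decomp t' y yt.
  have c_neq0 : c != 0.
    by apply: contraNneq yG => c0'; rewrite yc c0' scale0r addr0.
  have eqc : c *: sval t = c' *: sval t'.
    have := congr1 (mulmx^~ K) (etrans (esym yc) yc').
    by rewrite !mulmxDl -!scalemxAl !aK !GK // !add0r.
  have ecc : c = c'.
    have := congr1 (fun d => B (d *m P) x) eqc.
    by rewrite /= -!scalemxAl !pairingZl (eqP (valP t)) (eqP (valP t')) !mulr1.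
  by apply: val_inj; apply: (scalerI c_neq0); rewrite [LHS]eqc ecc.
- move=> t; have [OX Xp] := XP t; split=> //; apply: subv_trans Xp _.
  rewrite subv_add (subv_trans (capvSl _ _) (addvSl _ _)) /= -memvE /a addrC.
  apply: memv_add; first by rewrite memvZ.
  by apply/memv_imgP; exists (sval t); rewrite ?memvf ?lfunE.
Qed.

(** Expanding the left argument in a basis of [U] suffices, so nothing is asked of [g]. *)
Lemma rank_le_pairing (I J : Type) (f : I -> V) (g : J -> V) U : (forall i, f i \in U) ->
  rank_le (fun i j => B (f i) (g j)) (\dim U).
Proof.
move=> fU; exists 'I_(\dim U), (fun i => (coord (vbasis U))^~ (f i)),
  (fun j (t : 'I_(\dim U)) => B (vbasis U)`_t (g j)).
split=> [|i j]; first by rewrite card_ord.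
rewrite [in LHS](coord_vbasis (fU i)) pairing_suml; apply: eq_bigr => t _.
by rewrite pairingZl.
Qed.

Lemma block_bound p h : prime p -> #|F| = (p ^ h)%N ->
  (#|F| ^ r <= #|F| * ((1 + ((r + r) ^ p.-1) ^ h) ^ k) ^ k)%N.
Proof.
move=> p_pr qE; have charFp := card_finPcharP qE p_pr.
have [T [X [V0 [cardT dimV0 X_inj XP]]]] := many_blocks.
apply: leq_trans cardT _; rewrite leq_mul2l; apply/orP; right.
pose x t (i : 'I_k) := (vbasis (X t))`_i.
have sizeX t : size (vbasis (X t)) = k by rewrite size_tuple; case: (O_tiso (XP t).1).
(* [1 - c ^+ (q - 1)] is the indicator of [c = 0]. *)
have power1 c : c != 0 -> 1 - c ^+ (p ^ h).-1 = 0 :> F.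
  move=> c0; rewrite -qE; apply/eqP; rewrite subr_eq0 eq_sym; apply/eqP.
  by apply: (mulfI c0); rewrite -exprS prednK ?mulr1 ?expf_card // (cardD1 0).
(* This needs [q > 1], as [0 ^+ 0] is 1. *)
have power0 : 1 - 0 ^+ (p ^ h).-1 = 1 :> F.
  rewrite expr0n -qE; suff /negPf -> : #|F|.-1 != 0%N by rewrite subr0.
  by rewrite -lt0n -subn1 subn_gt0 card_finNzRing_gt1.
apply: (@rank_le_id F).
apply: (@rank_le_ext _ _ _ _
  (fun t t' => \prod_(i < k) \prod_(j < k) (1 - B (x t i) (x t' j) ^+ (p ^ h).-1))).
  move=> t t'; have [<- | neq_t] := eqVneq t t'.
    have tX : tiso (X t) by case: (O_tiso (XP t).1).
    rewrite big1 // => i _; rewrite big1 // => j _.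
    by rewrite (tiso_perp geom tX) ?power0 // vbasis_mem // mem_nth ?sizeX.
  rewrite mulr0n; apply/esym/eqP; apply: contraNT neq_t.
  move=> /prodf_neq0 nz; apply/eqP/X_inj/(O_perp_eq (XP t).1 (XP t').1) => a b.
  move=> /(nthP 0)[i]; rewrite sizeX => ltik <- /(nthP 0)[j]; rewrite sizeX => ltjk <-.
  apply: contraTeq isT => Bnz.
  have /prodf_neq0/(_ (Ordinal ltjk) isT) := nz (Ordinal ltik) isT.
  by rewrite power1 ?eqxx.
apply: rank_le_prod => i; apply: rank_le_prod => j.
apply: rank_leD; first exact: rank_le_const.
apply: rank_leN; have xV0 t : x t i \in V0.
  by apply: (subvP (XP t).2); rewrite vbasis_mem // mem_nth ?sizeX.
apply: (rank_le_mono _ (rank_le_pred_expn h charFp (rank_le_pairing _ xV0))).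
have mono e m1 m2 : (m1 <= m2 -> m1 ^ e <= m2 ^ e)%N by case: e => // e; rewrite leq_exp2r.
by rewrite !mono.
Qed.

End Blocks.

End PolarGeometry.

(** * The axioms for each kind of classical form *)

Section ClassicalGeometries.
Local Open Scope ring_scope.
Variables (F : finFieldType) (n : nat).
Notation V := 'rV[F]_n.

(** Shared by alternating and Hermitian forms. A line is isotropic once its spanning vector is, so
    [tiso_translate] reduces to one equation in [c]. *)
Lemma sesquilinear_geometry (f : V -> V -> F) (N : V -> 'cV[F]_n) :
  (forall u v, f u v = pairing N u v) -> reflexive_pairing N -> nondeg_form f ->
  (forall v x, f x x = 0 -> f v x = 1 -> exists c, f (v + c *: x) (v + c *: x) = 0) ->
  polar_geometry N (fun U => forall u v, u \in U -> v \in U -> f u v = 0).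
Proof.
move=> fE reflN ndf trf.
have isoZ w c d : f w w = 0 -> f (c *: w) (d *: w) = 0.
  rewrite !fE => w0; rewrite pairingZl (pairing_refl reflN) ?mulr0 // pairingZl.
  by rewrite w0 mulr0.
split=> //.
- by move=> U W tU /subvP WU u v /WU uU /WU vU; apply: tU.
- by move=> U u v tU uU vU; rewrite -fE tU.
- move=> U u _ _ u0; apply: ndf => v; rewrite fE; exact: (pairing_refl reflN).
- move=> U a tU ta Ua.
  have aW w : w \in (U + <[a]>)%VS -> f w a = 0.
    move=> /memv_addP[u uU [_ /vlineP[c ->] ->]].
    by rewrite fE pairingDl pairingZl Ua // -fE ta ?memv_line // mulr0 addr0.
  have UW u w : u \in U -> w \in (U + <[a]>)%VS -> f w u = 0.
    move=> uU /memv_addP[u' u'U [_ /vlineP[c ->] ->]].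
    by rewrite fE pairingDl pairingZl -fE tU // (pairing_refl reflN (Ua u uU)) mulr0 addr0.
  move=> w w' /memv_addP[u uU [_ /vlineP[c ->] ->]] w'W.
  rewrite fE pairingDl pairingZl !(pairing_refl reflN (u := w')) ?mulr0 ?addr0 //.
    by rewrite -fE aW.
  by rewrite -fE UW.
- move=> v x tx vx.
  have [||c c0] := trf v x; [by apply: tx; apply: memv_line | by rewrite fE |].
  by exists c => _ _ /vlineP[d ->] /vlineP[d' ->]; apply: isoZ.
Qed.

Lemma alternating_geometry (M : 'M[F]_n) : cf_valid (AltForm M) ->
  exists N, polar_geometry N (cf_tiso (AltForm M)).
Proof.
move=> [altM ndM]; exists (fun v => M *m v^T).
apply: sesquilinear_geometry => //; first by move=> u v; rewrite /bform /pairing mulmxA.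
  exists (-1), id; split=> // u v; rewrite mulN1r /pairing !mulmxA.
  have := altM (u + v); rewrite /bform raddfD /= mulmxDr !mulmxDl.
  rewrite mxE [X in X + _]mxE [X in _ + X]mxE.
  have := altM u; have := altM v; rewrite /bform => -> ->.
  by rewrite add0r addr0 => /eqP; rewrite addr_eq0 => /eqP.
by move=> v x _ _; exists 0; apply: altM.
Qed.

Lemma quadratic_geometry (A : 'M[F]_n) : cf_valid (QuadForm A) ->
  exists N, polar_geometry N (cf_tiso (QuadForm A)).
Proof.
move=> ndA; pose N (v : V) := (A + A^T) *m v^T; exists N.
have trE u v : (u *m A^T *m v^T) 0 0 = (v *m A *m u^T) 0 0.
  have <- : (v *m A *m u^T)^T 0 0 = (v *m A *m u^T) 0 0 by rewrite mxE.
  by rewrite !trmx_mul trmxK mulmxA.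
have NE u v : pairing N u v = qpolar A u v.
  have D00 (X Y : 'M[F]_1) : (X + Y) 0 0 = X 0 0 + Y 0 0 by rewrite mxE.
  rewrite /pairing mulmxA mulmxDr mulmxDl D00 trE /qpolar /qform raddfD /= !mulmxDr !mulmxDl.
  by rewrite !D00; ring.
have qD u v : qform A (u + v) = qform A u + qform A v + pairing N u v.
  by rewrite NE /qpolar; ring.
have qZ c v : qform A (c *: v) = c * c * qform A v.
  by rewrite /qform linearZ /= -!scalemxAl -scalemxAr !mxE mulrA.
have symN u v : pairing N v u = pairing N u v.
  by rewrite !NE /qpolar [v + u]addrC; ring.
split.
- by exists 1, id; split=> // u v; rewrite mul1r.
- by move=> U W tU /subvP WU u /WU; apply: tU.
- move=> U u v tU uU vU; rewrite NE /qpolar !tU ?subr0 //; exact: memvD.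
- by move=> U u tU uU u0; apply: ndA => [|v]; rewrite ?tU // -NE symN.
- move=> U a tU ta Ua _ /memv_addP[u uU [_ /vlineP[c ->] ->]].
  by rewrite qD qZ tU // ta ?memv_line // symN pairingZl symN Ua // !mulr0 !addr0.
(* As [x] is singular and pairs to 1 with [v], the form takes the value [qform A v + c] at
   [v + c *: x]. *)
- move=> v x tx vx; exists (- qform A v) => _ /vlineP[d ->].
  rewrite qZ qD qZ (tx x (memv_line x)) symN pairingZl symN vx mulr0 addr0 mulr1 subrr.
  by rewrite mulr0.
Qed.

(* The trace is a polynomial function of degree [e < #|F|], so it does not vanish identically. *)
Lemma trace_onto (e : nat) (s : F) : (1 < e)%N -> (e * e = #|F|)%N ->
  {morph (fun x : F => x ^+ e) : c d / c + d} -> s ^+ e = s -> exists c, c ^+ e + c = s.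
Proof.
move=> e_gt1 ee eD se.
have [d d0] : exists d : F, d ^+ e + d != 0.
  have [/existsP // | /existsPn all0] := boolP [exists d : F, d ^+ e + d != 0].
  pose P : {poly F} := 'X^e + 'X.
  have sizeP : size P = e.+1 by rewrite size_polyDl size_polyXn ?size_polyX.
  have := @max_poly_roots _ P (enum F).
  rewrite -cardE sizeP -size_poly_gt0 sizeP enum_uniq => /(_ isT _ isT).
  have -> : all (root P) (enum F).
    apply/allP => d _; rewrite /root !hornerE; have := all0 d; by rewrite negbK.
  by move=> /(_ isT); rewrite -ee; nia.
(* The trace is linear over elements fixed by the [e]-th power, such as [s / u]; so it suffices to
   rescale [d]. *)
pose u := d ^+ e + d; have ue : u ^+ e = u by rewrite eD -exprM ee expf_card addrC.
exists (s * d / u); rewrite !exprMn exprVn se ue -mulrDl -mulrDr.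
by rewrite -/u mulfK.
Qed.

Lemma hermitian_geometry p h e (M : 'M[F]_n) : prime p -> #|F| = (p ^ h)%N ->
  cf_valid (HermForm e M) -> exists N, polar_geometry N (cf_tiso (HermForm e M)).
Proof.
move=> p_pr qE [ee [symM ndM]]; have charFp := card_finPcharP qE p_pr.
have e_gt1 : (1 < e)%N by have := card_finNzRing_gt1 F; rewrite -ee; case: e {ee symM ndM} => [|[]].
have eD : {morph (fun x : F => x ^+ e) : c d / c + d}.
  (* As a divisor of [p ^ h], [e] is a power of [p], which makes [x ^+ e] additive. *)
  have [m _ em] : exists2 m, (m <= h)%N & e = (p ^ m)%N.
    by apply/dvdn_pfactor => //; rewrite -qE -ee dvdn_mulr.
  move=> c d /=; rewrite exprDn_pchar // em pnatX; apply/orP; left.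
  by rewrite pnatE.
exists (fun v => M *m (map_mx (fun x => x ^+ e) v)^T).
have BE u v : sform e M u v = pairing (fun v => M *m (map_mx (fun x => x ^+ e) v)^T) u v.
  by rewrite /sform /pairing mulmxA.
apply: sesquilinear_geometry => //.
  exists 1, (fun x => x ^+ e); split=> // [c d|c|u v]; first exact: exprMn.
    by move=> /eqP; rewrite expf_eq0 => /andP[_ /eqP].
  by rewrite mul1r -!BE symM.
move=> v x x0 vx; set s := sform e M v v.
have se : s ^+ e = s by rewrite -symM.
(* The form at [v + c *: x] equals [s + c ^+ e + c], so [c] must have trace [- s]. *)
have [|c cs] := @trace_onto e (- s) e_gt1 ee eD.
  apply/eqP; rewrite -subr_eq0 opprK -{2}se -eD addNr expr0n.
  by case: e e_gt1 {ee eD symM ndM x0 vx s se BE} => [|[]].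
have DZ u w : sform e M (u + c *: x) w = sform e M u w + c * sform e M x w.
  by rewrite !BE pairingDl pairingZl.
have xv : sform e M x v = 1 by rewrite symM vx expr1n.
have vw : sform e M v (v + c *: x) = s + c ^+ e by rewrite symM DZ xv mulr1 eD se.
have xw : sform e M x (v + c *: x) = 1 by rewrite symM DZ x0 vx mulr0 addr0 expr1n.
by exists c; rewrite DZ vw xw mulr1 -addrA cs subrr.
Qed.

End ClassicalGeometries.

(** * Exponential against polynomial growth *)

Section Arithmetic.

(** With [H = L./2], [2 ^ L] is at least [(H + 1) ^ 2], and [8 * m + 8] forces [H > 4 * m]. *)
Lemma linear_lt_expn m : exists L0, forall L, (L0 <= L)%N -> ((L + 2) * m + 1 < 2 ^ L)%N.
Proof.
exists (8 * m + 8)%N => L leL; have := ltn_expl L./2 (isT : 1 < 2)%N.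
have := odd_double_half L; rewrite -addnn => LE ltL.
have : (2 ^ (L./2 + L./2) <= 2 ^ L)%N by rewrite leq_exp2l // -[leqRHS]LE leq_addl.
apply: leq_trans; rewrite expnD.
apply: (@leq_trans ((L./2).+1 * (L./2).+1)%N); last exact: leq_mul.
have : (odd L <= 1)%N by case: (odd L).
move: (odd L : nat) LE => o LE leo; nia.
Qed.

(** For [L = trunc_log 2 r], the left side is at most [2 ^ ((L + 2) * m)], while [r] is at least
    [2 ^ L]; comparing exponents leaves the linear bound. *)
Lemma poly_lt_expn m : exists r0, forall r, (r0 <= r)%N -> ((r + r) ^ m < 2 ^ r.-1)%N.
Proof.
have [L0 HL] := linear_lt_expn m; exists (2 ^ L0)%N => r ler.
have r_gt0 : (0 < r)%N by apply: leq_trans ler; rewrite expn_gt0.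
have leL : (L0 <= trunc_log 2 r)%N by apply: trunc_log_max.
have lt2 := trunc_log_ltn r (isT : 1 < 2)%N.
have le2 := trunc_logP (isT : 1 < 2)%N r_gt0.
apply: (@leq_ltn_trans (2 ^ ((trunc_log 2 r + 2) * m))).
  rewrite expnM; case: m {HL} => // m; rewrite leq_exp2r // addn2 expnS; lia.
by rewrite ltn_exp2l //; have := HL _ leL; lia.
Qed.

(** Both sides are compared as [h]-th powers, so [r0] is independent of [h]. *)
Lemma block_bound_fails p k : (1 < p)%N -> exists r0, forall r h, (r0 <= r)%N -> (0 < h)%N ->
  (p ^ h * ((1 + ((r + r) ^ p.-1) ^ h) ^ k) ^ k < (p ^ h) ^ r)%N.
Proof.
move=> p_gt1; have [r0 Hr] := poly_lt_expn (p * k * k); exists r0.+1 => r h ler h_gt0.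
have r_gt0 : (0 < r)%N by lia.
have mono e m1 m2 : (m1 <= m2 -> m1 ^ e <= m2 ^ e)%N by case: e => // e; rewrite leq_exp2r.
apply: (@leq_ltn_trans ((p * (r + r) ^ (p * k * k)) ^ h)).
  rewrite expnMn leq_mul2l; apply/orP; right.
  rewrite -!expnM [(p * k * k * h)%N](_ : _ = p * h * k * k)%N; last by ring.
  rewrite !expnM; do 2!apply/mono.
  rewrite -!expnM.
  (* The summand 1 is absorbed by one more factor [r + r], and [(p - 1) * h + 1 <= p * h] because
     [h] is positive. *)
  apply: (@leq_trans ((r + r) ^ (p.-1 * h).+1)); last by rewrite leq_pexp2l; nia.
  rewrite expnS; have : (0 < (r + r) ^ (p.-1 * h))%N by rewrite expn_gt0; lia.
  nia.
rewrite -expnM [(h * r)%N]mulnC (expnM p r h) ltn_exp2r // -(prednK r_gt0) expnS.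
rewrite ltn_pmul2l; last by lia.
rewrite prednK //; apply: leq_trans (Hr r _) (mono _ _ _ p_gt1); lia.
Qed.

End Arithmetic.

Theorem theorem1p1 :
  forall (p k : nat), prime p -> (0 < k)%N ->
  exists r0 : nat, forall r : nat, (r0 <= r)%N ->
  forall h : nat, (0 < h)%N ->
  forall (F : finFieldType), #|F| = (p ^ h)%N ->
  forall (n : nat) (f : classical_form F n),
    cf_valid f -> polar_rank f r ->
    ~ (exists O : {vspace 'rV[F]_n} -> Prop,
         (forall X, O X -> cf_tiso f X /\ \dim X = k) /\
         (forall G, generator f r G ->
            exists! X, O X /\ (X <= G)%VS)).
Proof.
move=> p k p_pr k_gt0; have [r0 Hr] := block_bound_fails k (prime_gt1 p_pr).
exists r0 => r ler h h_gt0 F qE n f f_valid [rank_exists rank_max] [O [O_tiso O_unique]].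
have [N geom] : exists N, polar_geometry N (cf_tiso f).
  case: f f_valid {rank_exists rank_max O_tiso O_unique} => [A|M|e M] f_valid.
  - exact: quadratic_geometry.
  - exact: alternating_geometry.
  - exact: hermitian_geometry qE f_valid.
have := block_bound geom rank_exists rank_max k_gt0 O_tiso
  (fun G tG dG => O_unique G (conj tG dG)) p_pr qE.
by rewrite leqNgt qE Hr.
Qed.
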